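(* Let $\mathfrak{L}$ be a non-zero left Leibniz algebra over a field $\mathbb{F}$ whose canonical Lie algebra $\mathfrak{L}_{\mathrm{Lie}}$ is finite dimensional. Then the Grothendieck ring $\mathrm{Gr}^{\mathrm{bi}}(\mathfrak{L})$ is not associative.
   Context: Rings are not assumed associative. The field $\mathbb{F}$ is arbitrary. A left Leibniz algebra is an $\mathbb{F}$-vector space $\mathfrak{L}$ with a bilinear multiplication satisfying $x(yz)=(xy)z+y(xz)$. Its canonical Lie algebra is $\mathfrak{L}_{\mathrm{Lie}}:=\mathfrak{L}/\mathrm{Leib}(\mathfrak{L})$, where $\mathrm{Leib}(\mathfrak{L}):=\langle x^2\mid x\in\mathfrak{L}\rangle_{\mathbb{F}}$ (an ideal). An $\mathfrak{L}$-bimodule is an $\mathbb{F}$-vector space $M$ with bilinear left and right $\mathfrak{L}$-actions satisfying, for all $x,y\in\mathfrak{L}$, $m\in M$: (LLM) $(xy)\cdot m=x\cdot(y\cdot m)-y\cdot(x\cdot m)$; (LML) $(x\cdot m)\cdot y=x\cdot(m\cdot y)-m\cdot(xy)$; (MLL) $(m\cdot x)\cdot y=m\cdot(xy)-x\cdot(m\cdot y)$. For $\mathfrak{L}$-bimodules $M,N$, the space $M\otimes N$ (over $\mathbb{F}$) carries the actions $x\cdot(m\otimes n):=(x\cdot m)\otimes n+m\otimes(x\cdot n)$ and $(m\otimes n)\cdot x:=(m\cdot x)\otimes n+m\otimes(n\cdot x)$. Let $T(M,N)$ be the smallest subspace of $M\otimes N$ closed under both actions and containing all elements $(x\cdot m+m\cdot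 x)\otimes(n\cdot y)+(m\cdot y)\otimes(x\cdot n+n\cdot x)$ with $x,y\in\mathfrak{L}$, $m\in M$, $n\in N$. The truncated tensor product $M\,\overline{\otimes}\,N:=(M\otimes N)/T(M,N)$ is an $\mathfrak{L}$-bimodule. $\mathrm{Gr}^{\mathrm{bi}}(\mathfrak{L})$ is the free abelian group on the set $\mathrm{Irr}^{\mathrm{bi}}(\mathfrak{L})$ of isomorphism classes of finite-dimensional irreducible $\mathfrak{L}$-bimodules; each finite-dimensional $\mathfrak{L}$-bimodule $X$ has a class $[X]:=\sum_{[L]}[X:L][L]$, where $[X:L]$ is the composition multiplicity. Its multiplication is the biadditive extension of $[M]\cdot[N]:=[M\,\overline{\otimes}\,N]$ for $[M],[N]\in\mathrm{Irr}^{\mathrm{bi}}(\mathfrak{L})$. *)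

(* Defs.v *)
From HB Require Import structures.
From mathcomp Require Import all_boot all_order all_algebra.
From mathcomp Require Import finmap generic_quotient ring_quotient sesquilinear.
From mathcomp Require Import boolp classical_sets functions cardinality fsbigop.
From mathcomp Require Import freeg ring.

Set Implicit Arguments.
Unset Strict Implicit.
Unset Printing Implicit Defensive.

Import GRing.Theory VectorInternalTheory.
Local Open Scope ring_scope.
Local Open Scope quotient_scope.

(** * Quotients of vector spaces *)

Section LmodQuotient.
Variables (F : fieldType) (V : lmodType F) (I : submodClosed V).

Let S : {pred V} := GRing.SubmodClosed.sort I.
HB.instance Definition _ := GRing.isZmodClosed.Build V S (GRing.submod_closedB (submodClosedP I)).

Definition lmod_quot : Type := Quotient.quot S.

HB.instance Definition _ := GRing.Zmodule.on lmod_quot.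

Definition lpi : V -> lmod_quot := \pi_(Quotient.quot S).
Definition lrepr : lmod_quot -> V := @repr _ (Quotient.quot S).

Lemma lreprK q : lpi (lrepr q) = q.
Proof. exact: reprK. Qed.

Lemma lpi_surj q : exists v, q = lpi v.
Proof. by exists (lrepr q); rewrite lreprK. Qed.

Lemma eq_lpi u v : lpi u = lpi v <-> u - v \in I.
Proof.
have -> : (u - v \in I) = (u == v %[mod Quotient.quot S])%qT.
  exact: (@Quotient.idealrBE V S u v).
by split=> /eqP.
Qed.

Lemma lrepr_lpi v : lrepr (lpi v) - v \in I.
Proof. by apply/eq_lpi; rewrite lreprK. Qed.

Lemma lpiB : {morph lpi : x y / x - y}.
Proof. by move=> x y; rewrite /lpi !piE. Qed.

Definition lscale (a : F) (q : lmod_quot) : lmod_quot := lpi (a *: lrepr q).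

Lemma lscaleE a v : lscale a (lpi v) = lpi (a *: v).
Proof. by apply/eq_lpi; rewrite -scalerBr rpredZ ?lrepr_lpi. Qed.

Fact lscaleA a b q : lscale a (lscale b q) = lscale (a * b) q.
Proof. by rewrite -[q]lreprK !lscaleE scalerA. Qed.
Fact lscale1 : left_id 1 lscale.
Proof. by move=> q; rewrite -[q]lreprK lscaleE scale1r. Qed.
Fact lpiD : {morph lpi : x y / x + y}.
Proof. by move=> x y; rewrite /lpi !piE. Qed.
Fact lscaleDr : right_distributive lscale +%R.
Proof.
by move=> a p q; rewrite -[p]lreprK -[q]lreprK -lpiD !lscaleE scalerDr lpiD.
Qed.
Fact lscaleDl q : {morph lscale^~ q : a b / a + b}.
Proof. by move=> a b; rewrite -[q]lreprK !lscaleE scalerDl lpiD. Qed.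

HB.instance Definition _ := GRing.Zmodule_isLmodule.Build F lmod_quot
  lscaleA lscale1 lscaleDr lscaleDl.

Fact lpi_is_linear : linear lpi.
Proof. by move=> a u v; rewrite lpiD -lscaleE. Qed.

HB.instance Definition _ := GRing.isLinear.Build F V lmod_quot *:%R lpi
  lpi_is_linear.

End LmodQuotient.

Section VectQuotient.
Variables (F : fieldType) (V : vectType F) (U : {vspace V}).

Definition vect_quot : Type := lmod_quot (pred_of_vspace U : submodClosed V).

HB.instance Definition _ := GRing.Lmodule.on vect_quot.

(* V / U is linearly isomorphic to any complement of U. *)
Fact vect_quot_axiom : Vector.axiom (dim (subvs_of U^C)) vect_quot.
Proof.
pose p := daddv_pi U^C U.
have pP v : v - p v \in U.
  have dUC : (U^C :&: U = 0)%VS by rewrite capvC capv_compl.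
  have vUC : v \in (U^C + U)%VS by rewrite addvC addv_complf memvf.
  by rewrite -{1}(daddv_pi_add dUC vUC) addrC addKr memv_pi.
have p0 u : u \in U -> p u = 0.
  move=> uU; apply/eqP; rewrite -memv0 -(capv_compl U) memv_cap memv_pi andbT.
  by rewrite -[p u](subKr u) rpredB.
pose f (q : vect_quot) : 'rV_(dim (subvs_of U^C)) :=
  v2r (vsproj U^C (p (lrepr q))).
have fE v : f (lpi _ v) = v2r (vsproj U^C (p v)).
  congr (v2r (vsproj _ _)); apply/eqP; rewrite -subr_eq0 -linearB /=.
  by rewrite p0 ?lrepr_lpi.
exists f.
  move=> a q1 q2; rewrite -[q1]lreprK -[q2]lreprK -linearP !fE.
  by rewrite !linearP.
exists (fun r => lpi _ (vsval (r2v r : subvs_of U^C))).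
  move=> q; rewrite -[q]lreprK fE v2rK vsprojK ?memv_pi //.
  by apply/esym/eq_lpi/pP.
move=> r; rewrite fE -[RHS]r2vK; congr v2r; apply: val_inj => /=.
rewrite vsprojK ?memv_pi //.
set w := vsval _; have wU : w \in U^C%VS by apply: subvsP.
apply/esym/eqP; rewrite -subr_eq0 -memv0 -(capv_compl U) memv_cap pP.
by rewrite rpredB ?memv_pi.
Qed.

HB.instance Definition _ := Lmodule_hasFinDim.Build F vect_quot vect_quot_axiom.

End VectQuotient.

Definition finite_dimensional (F : fieldType) (V : lmodType F) : Prop :=
  exists s : seq V, forall v, exists c : 'I_(size s) -> F,
    v = \sum_i c i *: s`_i.

(** * Left Leibniz algebras *)

HB.mixin Record Lmodule_isLeibniz (F : fieldType) L of GRing.Lmodule F L := {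
  lmul : {bilinear L -> L -> L};
  lmul_leibniz : forall x y z : L,
    lmul x (lmul y z) = lmul (lmul x y) z + lmul y (lmul x z)
}.

#[short(type="leibnizType")]
HB.structure Definition Leibniz (F : fieldType) :=
  {L of GRing.Lmodule F L & Lmodule_isLeibniz F L}.


Declare Scope leibniz_scope.
Local Open Scope leibniz_scope.
Local Notation "x ** y" := (lmul x y)
  (at level 40, left associativity) : leibniz_scope.

Definition bilinear_of (F : fieldType) (U U' V : lmodType F)
    (f : U -> U' -> V) (fP : bilinear_for *:%R *:%R f) :
    {bilinear U -> U' -> V} :=
  HB.pack_for {bilinear U -> U' -> V} f
    (bilinear_isBilinear.Build F U U' V *:%R *:%R f fP).

Section CanonicalLie.
Variables (F : fieldType) (L : leibnizType F).
Implicit Types x y z : L.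

(* Leib(L), the linear span of the squares. *)
Definition leib_kernel : {pred L} := fun x =>
  `[< exists s : seq (F * L), x = \sum_(p <- s) p.1 *: (p.2 ** p.2) >].

Fact leib_kernel_submod : submod_closed leib_kernel.
Proof.
split; first by apply/asboolP; exists [::]; rewrite big_nil.
move=> a x y /asboolP[s ->] /asboolP[t ->]; apply/asboolP.
exists ([seq (a * p.1, p.2) | p <- s] ++ t).
rewrite big_cat big_map scaler_sumr; congr (_ + _).
by apply: eq_bigr => p _; rewrite scalerA.
Qed.

HB.instance Definition _ := GRing.isSubmodClosed.Build F L leib_kernel
  leib_kernel_submod.

Fact leib_kernel_sq x : x ** x \in leib_kernel.
Proof. by apply/asboolP; exists [:: (1, x)]; rewrite big_seq1 scale1r. Qed.

Fact leib_kernel_mull x y : y \in leib_kernel -> x ** y \in leib_kernel.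
Proof.
move=> /asboolP[s ->]; rewrite linear_sumr rpred_sum // => -[a z] _ /=.
rewrite linearZr rpredZ // lmul_leibniz.
have -> : (x ** z) ** z + z ** (x ** z) =
    (x ** z + z) ** (x ** z + z) - (x ** z) ** (x ** z) - z ** z.
  have aux (p q r t : L) : q + r = p + q + (r + t) - p - t.
    by rewrite -(addrA p) (addrC p) addrK addrA addrK.
  by rewrite linearDl !linearDr; apply: aux.
by rewrite rpredB ?leib_kernel_sq // rpredB ?leib_kernel_sq.
Qed.

Fact leib_kernel_mulr x y : y \in leib_kernel -> y ** x = 0.
Proof.
move=> /asboolP[s ->]; rewrite linear_sumlz big1 // => -[a z] _ /=.
rewrite linearZl_LR; apply/eqP; rewrite scaler_eq0; apply/orP; right.
by have /eqP := lmul_leibniz z z x; rewrite -subr_eq0 opprD addrCA subrr addr0 oppr_eq0.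
Qed.

Definition canonical_lie : Type := lmod_quot leib_kernel.

HB.instance Definition _ := GRing.Lmodule.on canonical_lie.

Local Notation pi := (@lpi F L leib_kernel : L -> canonical_lie).

Definition lie_mul (p q : canonical_lie) : canonical_lie :=
  pi (lrepr p ** lrepr q).

Lemma lie_mulE x y : lie_mul (pi x) (pi y) = pi (x ** y).
Proof.
apply/eq_lpi; set x' := lrepr _; set y' := lrepr _.
have -> : x' ** y' - x ** y = x' ** (y' - y) + (x' - x) ** y.
  by rewrite linearBl linearBr /= addrA subrK.
apply: rpredD; first exact/leib_kernel_mull/lrepr_lpi.
by rewrite (@leib_kernel_mulr y (x' - x)) ?rpred0 //; apply: lrepr_lpi.
Qed.

Fact lie_mul_bilinear : bilinear_for *:%R *:%R lie_mul.
Proof.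
split=> [q a p p'|p a q q'].
  rewrite -[q]lreprK -[p]lreprK -[p']lreprK -linearP !lie_mulE.
  by rewrite linearPl linearP.
rewrite -[q]lreprK -[p]lreprK -[q']lreprK -linearP !lie_mulE.
by rewrite linearPr linearP.
Qed.

Fact lie_mul_leibniz p q r :
  lie_mul p (lie_mul q r) = lie_mul (lie_mul p q) r + lie_mul q (lie_mul p r).
Proof.
rewrite -[p]lreprK -[q]lreprK -[r]lreprK !lie_mulE -linearD.
by rewrite -lmul_leibniz.
Qed.

HB.instance Definition _ := Lmodule_isLeibniz.Build F canonical_lie
  (lmul := bilinear_of lie_mul_bilinear) lie_mul_leibniz.

Lemma lie_mulxx (p : canonical_lie) : p ** p = 0.
Proof.
rewrite -[p]lreprK [LHS]lie_mulE -(linear0 pi); apply/eq_lpi.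
by rewrite subr0 leib_kernel_sq.
Qed.

End CanonicalLie.

(** * Bimodules *)

(* Bimodules carry a [vectType], so they are finite dimensional, which is all
   the Grothendieck ring involves; the algebra itself may be infinite
   dimensional. *)
Definition bimodule_law (F : fieldType) (L : leibnizType F) (V : vectType F)
    (l : {bilinear L -> V -> V}) (r : {bilinear V -> L -> V}) : Prop :=
  [/\ forall x y m, l (x ** y) m = l x (l y m) - l y (l x m),
      forall x y m, r (l x m) y = l x (r m y) - r m (x ** y)
    & forall x y m, r (r m x) y = r m (x ** y) - l x (r m y)].

Record bimodule (F : fieldType) (L : leibnizType F) := Bimodule {
  bimodule_sort :> vectType F;
  lact : {bilinear L -> bimodule_sort -> bimodule_sort};
  ract : {bilinear bimodule_sort -> L -> bimodule_sort};
  bimoduleP : bimodule_law lact ract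
}.

Local Notation "x *> m" := (lact _ x m)
  (at level 40, left associativity) : leibniz_scope.
Local Notation "m <* x" := (ract _ m x)
  (at level 40, left associativity) : leibniz_scope.

Section BimoduleLaw.
Variables (F : fieldType) (L : leibnizType F) (M : bimodule L).

Lemma bimodule_LLM x y (m : M) : (x ** y) *> m = x *> (y *> m) - y *> (x *> m).
Proof. by case: (bimoduleP M). Qed.

Lemma bimodule_LML x y (m : M) : (x *> m) <* y = x *> (m <* y) - m <* (x ** y).
Proof. by case: (bimoduleP M). Qed.

Lemma bimodule_MLL x y (m : M) : (m <* x) <* y = m <* (x ** y) - x *> (m <* y).
Proof. by case: (bimoduleP M). Qed.

End BimoduleLaw.

Definition bimodule_iso (F : fieldType) (L : leibnizType F)
    (M N : bimodule L) : Prop :=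
  exists f : {linear M -> N}, [/\ bijective f,
    forall x m, f (x *> m) = x *> f m & forall x m, f (m <* x) = f m <* x].

Section BimoduleIso.
Variables (F : fieldType) (L : leibnizType F).
Implicit Types M N K : bimodule L.

Lemma bimodule_iso_refl M : bimodule_iso M M.
Proof. by exists idfun; split=> //; exists idfun. Qed.

Lemma bimodule_iso_sym M N : bimodule_iso M N -> bimodule_iso N M.
Proof.
move=> [f [[g fK gK] fl fr]].
have lin_g : linear g.
  by move=> a u v; apply: (can_inj fK); rewrite gK linearP !gK.
pose G : {linear N -> M} :=
  HB.pack g (GRing.isLinear.Build F N M *:%R g lin_g).
exists G; split=> [|x n|n x] /=; first by exists f.
  by apply: (can_inj fK); rewrite fl !gK.
by apply: (can_inj fK); rewrite fr !gK.
Qed.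

Lemma bimodule_iso_trans M N K :
  bimodule_iso M N -> bimodule_iso N K -> bimodule_iso M K.
Proof.
move=> [f [fb fl fr]] [g [gb gl gr]].
exists (g \o f); split=> [|x m|m x] /=; first exact: bij_comp.
  by rewrite fl gl.
by rewrite fr gr.
Qed.

End BimoduleIso.

Section Stable.
Variables (F : fieldType) (L : leibnizType F) (V : vectType F).
Variables (l : {bilinear L -> V -> V}) (r : {bilinear V -> L -> V}).

Definition stable (U : {vspace V}) : Prop :=
  forall x v, v \in U -> l x v \in U /\ r v x \in U.

Lemma stable0 : stable 0%VS.
Proof.
by move=> x v; rewrite memv0 => /eqP ->; rewrite linear0r linear0l mem0v.
Qed.

Lemma stablef : stable fullv.
Proof. by move=> x v _; rewrite !memvf. Qed.

Lemma stableI U W : stable U -> stable W -> stable (U :&: W)%VS.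
Proof.
move=> sU sW x v; rewrite memv_cap => /andP[vU vW]; rewrite !memv_cap.
by have [-> ->] := sU x v vU; have [-> ->] := sW x v vW.
Qed.

End Stable.

Section QuotientActions.
Variables (F : fieldType) (L : leibnizType F) (V : vectType F).
Variables (l : {bilinear L -> V -> V}) (r : {bilinear V -> L -> V}).
Variables (U : {vspace V}) (sU : stable l r U).

Local Notation Q := (vect_quot U).
Local Notation pi := (@lpi F V (pred_of_vspace U) : V -> Q).

Let quot_lact_fun (x : L) (q : Q) : Q := pi (l x (lrepr q)).
Let quot_ract_fun (q : Q) (x : L) : Q := pi (r (lrepr q) x).

Let lE x v : quot_lact_fun x (pi v) = pi (l x v).
Proof.
by apply/eq_lpi; rewrite -linearBr; apply: (sU _ _).1; apply: lrepr_lpi.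
Qed.

Let rE x v : quot_ract_fun (pi v) x = pi (r v x).
Proof.
by apply/eq_lpi; rewrite -linearBl; apply: (sU _ _).2; apply: lrepr_lpi.
Qed.

Fact quot_lact_bilinear : bilinear_for *:%R *:%R quot_lact_fun.
Proof.
split=> [q a x y|x a p q].
  by rewrite -[q]lreprK !lE linearPl linearP.
by rewrite -[p]lreprK -[q]lreprK -linearP !lE linearPr linearP.
Qed.

Fact quot_ract_bilinear : bilinear_for *:%R *:%R quot_ract_fun.
Proof.
split=> [x a p q|q a x y].
  by rewrite -[p]lreprK -[q]lreprK -linearP !rE linearPl linearP.
by rewrite -[q]lreprK !rE linearPr linearP.
Qed.

(* Locked, since unification may otherwise unfold [quot_lact x q] to a term of
   the form [lpi _ _]. *)
Definition quot_lact : {bilinear L -> Q -> Q} := locked (bilinear_of quot_lact_bilinear).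
Definition quot_ract : {bilinear Q -> L -> Q} := locked (bilinear_of quot_ract_bilinear).

Lemma quot_lactE x v : quot_lact x (pi v) = pi (l x v).
Proof. by rewrite /quot_lact -lock; apply: lE. Qed.

Lemma quot_ractE x v : quot_ract (pi v) x = pi (r v x).
Proof. by rewrite /quot_ract -lock; apply: rE. Qed.

End QuotientActions.

Record subbimodule (F : fieldType) (L : leibnizType F) (M : bimodule L) :=
  Subbimodule {
    subbimodule_vspace :> {vspace M};
    subbimoduleP : stable (lact M) (ract M) subbimodule_vspace
  }.

Section SubQuotient.
Variables (F : fieldType) (L : leibnizType F) (M : bimodule L).
Implicit Type U W : subbimodule M.

Definition subbimodule0 : subbimodule M := Subbimodule (stable0 (lact M) (ract M)).

Section Sub.
Variable U : subbimodule M.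

Let sub_lact_fun (x : L) (u : subvs_of U) : subvs_of U :=
  Subvs (subbimoduleP x (subvsP u)).1.
Let sub_ract_fun (u : subvs_of U) (x : L) : subvs_of U :=
  Subvs (subbimoduleP x (subvsP u)).2.

Fact sub_lact_bilinear : bilinear_for *:%R *:%R sub_lact_fun.
Proof.
by split=> [u a x y|x a u v]; apply: val_inj; rewrite /= ?linearPl ?linearPr.
Qed.

Fact sub_ract_bilinear : bilinear_for *:%R *:%R sub_ract_fun.
Proof.
by split=> [x a u v|u a x y]; apply: val_inj; rewrite /= ?linearPl ?linearPr.
Qed.

Fact sub_bimodule_law : bimodule_law (bilinear_of sub_lact_bilinear)
  (bilinear_of sub_ract_bilinear).
Proof.
split=> x y u; apply: val_inj => /=.
- exact: bimodule_LLM.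
- exact: bimodule_LML.
- exact: bimodule_MLL.
Qed.

Definition sub_bimodule : bimodule L := Bimodule sub_bimodule_law.

Let sU : stable (lact M) (ract M) U := @subbimoduleP F L M U.

Fact quot_bimodule_law : bimodule_law (quot_lact sU) (quot_ract sU).
Proof.
split=> x y q; have [v ->] := lpi_surj q; rewrite !(quot_lactE, quot_ractE).
- by rewrite bimodule_LLM linearB.
- by rewrite bimodule_LML linearB.
- by rewrite bimodule_MLL linearB.
Qed.

Definition quot_bimodule : bimodule L := Bimodule quot_bimodule_law.

End Sub.

Definition irreducible : Prop :=
  (exists m : M, m != 0) /\
  forall U, (U : {vspace M}) = 0%VS \/ (U : {vspace M}) = fullv.

End SubQuotient.

Section Factor.
Variables (F : fieldType) (L : leibnizType F) (M : bimodule L).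
Variables U W : subbimodule M.

Fact restrict_stable : stable (lact (sub_bimodule W)) (ract (sub_bimodule W))
  (linfun (vsval : subvs_of W -> M) @^-1: U)%VS.
Proof.
move=> x w; rewrite -!memv_preim !lfunE /= => wU.
exact: subbimoduleP.
Qed.

(* W / (W :&: U); this is W / U when U is contained in W. *)
Definition factor : bimodule L :=
  quot_bimodule (Subbimodule restrict_stable).

End Factor.

Section CompositionSeries.
Variables (F : fieldType) (L : leibnizType F) (M : bimodule L).
Implicit Types (U W : subbimodule M) (s : seq (subbimodule M)).

Fixpoint comp_chain U s : Prop :=
  if s is W :: s' then
    [/\ (U <= W)%VS, irreducible (factor U W) & comp_chain W s']
  else (U : {vspace M}) = fullv.

Definition composition_series s : Prop := comp_chain (subbimodule0 M) s.

Lemma factor_irreducible U W : (U <= W)%VS -> ~~ (W <= U)%VS ->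
  (forall S, stable (lact M) (ract M) S -> (U <= S)%VS -> (S <= W)%VS ->
    S = U \/ S = W) ->
  irreducible (factor U W).
Proof.
move=> UW /subvPn[w wW wU] minW.
pose R := (linfun (vsval : subvs_of W -> M) @^-1: U)%VS.
have RE (v : subvs_of W) : (v \in R) = (vsval v \in (U : {vspace M})).
  by rewrite -memv_preim lfunE.
have pi0 (v : subvs_of W) : lpi (pred_of_vspace R) v = 0 <-> vsval v \in (U : {vspace M}).
  rewrite -RE -{2}[v]subr0; apply: iff_trans (eq_lpi _ _ _).
  by rewrite linear0.
split.
  exists (lpi (pred_of_vspace R) (Subvs wW) : factor U W).
  by apply/eqP => /pi0; rewrite (negPf wU).
move=> T.
pose S := (linfun (vsval : subvs_of W -> M) @:
  (linfun (lpi (pred_of_vspace R) : subvs_of W -> vect_quot R) @^-1: T))%VS.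
have SP v : v \in S <-> exists2 v' : subvs_of W, vsval v' = v &
    (lpi (pred_of_vspace R) v' : vect_quot R) \in (T : {vspace factor U W}).
  split=> [/memv_imgP[v' vT ->]|[v' <- vT]].
    by exists v'; rewrite ?lfunE //; move: vT; rewrite -memv_preim lfunE.
  apply/memv_imgP; exists v'; last by rewrite lfunE.
  by rewrite -memv_preim lfunE.
have sS : stable (lact M) (ract M) S.
  move=> x v /SP[v' <- vT]; have [lT rT] := subbimoduleP x vT; split; apply/SP.
    exists (lact (sub_bimodule W) x v') => //.
    by move: lT; rewrite [lact _ _ _]quot_lactE.
  exists (ract (sub_bimodule W) v' x) => //.
  by move: rT; rewrite [ract _ _ _]quot_ractE.
have US : (U <= S)%VS.
  apply/subvP => u uU; have uW : u \in W by exact: (subvP UW).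
  apply/SP; exists (Subvs uW) => //; have /pi0 -> : vsval (Subvs uW) \in U by [].
  exact: mem0v.
have SW : (S <= W)%VS by apply/subvP => v /SP[v' <- _]; apply: subvsP.
have [SU|SU] := minW S sS US SW; [left|right]; apply/eqP.
  rewrite -subv0; apply/subvP => q qT; rewrite memv0; apply/eqP.
  have [v qE] := lpi_surj q; rewrite qE in qT *; apply/pi0.
  by rewrite -SU; apply/SP; exists v.
rewrite eqEsubv subvf; apply/subvP => q _; have [v ->] := lpi_surj q.
have /SP[v' /val_inj vv' v'T] : vsval v \in S by rewrite SU subvsP.
by rewrite -vv'.
Qed.

Lemma comp_chain_exists U : exists s, comp_chain U s.
Proof.
have [n] := ubnP (\dim {:M} - \dim U); elim: n U => // n IHn U leUn.
have [Uf|Uf] := eqVneq (U : {vspace M}) fullv; first by exists [::].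
pose P S := [/\ stable (lact M) (ract M) S, (U <= S)%VS & ~~ (S <= U)%VS].
have exP : exists d, `[< exists2 S, P S & \dim S = d >].
  exists (\dim {:M}); apply/asboolP; exists fullv => //.
  split; [exact: stablef | exact: subvf | apply: contra Uf => fU].
  by rewrite eqEsubv subvf.
case: (ex_minnP exP) => d /asboolP[W [sW UW WU] dW] minW.
pose W' := Subbimodule sW; have [|s sP] := IHn W'.
  have ltUW : (\dim U < \dim W)%N.
    by rewrite (ltn_leqif (dimv_leqif_sup UW)).
  move: leUn; rewrite ltnS; apply: leq_trans; apply: ltn_sub2l => //.
  exact: leq_trans ltUW (dimvS (subvf W)).
exists (W' :: s); split=> //; apply: factor_irreducible => // S sS US SW.
have [SU|SU] := boolP (S <= U)%VS; first by left; apply/eqP; rewrite eqEsubv SU.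
by right; apply/eqP; rewrite eqEdim SW dW minW //; apply/asboolP; exists S.
Qed.

Definition comp_series : seq (subbimodule M) :=
  sval (cid (comp_chain_exists (subbimodule0 M))).

Lemma comp_seriesP : composition_series comp_series.
Proof. exact: (svalP (cid _)). Qed.

(* By Jordan-Hoelder, the factors of the chosen composition series are, up to
   order and isomorphism, those of any composition series. *)
Definition comp_factors : seq (bimodule L) :=
  pairmap (@factor F L M) (subbimodule0 M) comp_series.

Definition comp_mult (N : bimodule L) : nat :=
  count (fun K => `[< bimodule_iso K N >]) comp_factors.

End CompositionSeries.

(** * Tensor products *)

Section Tensor.
Variables (F : fieldType) (M N : vectType F).

(* A tensor is represented by its matrix of coordinates in the basis of all
   [tens e_i e_j], for the bases of M and N underlying [v2r]; [tens_liftE] and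
   [tens_ext] are the universal property. *)
Definition tensor : Type := 'M[F]_(dim M, dim N).

HB.instance Definition _ := Vector.on tensor.

Definition tens (m : M) (n : N) : tensor := (v2r m)^T *m v2r n.

Fact tens_bilinear : bilinear_for *:%R *:%R tens.
Proof.
split=> [n a m m'|m a n n']; rewrite /tens; last by rewrite linearP linearP.
by rewrite linearP /= linearP /= mulmxDl -scalemxAl.
Qed.

HB.instance Definition _ := bilinear_isBilinear.Build F M N tensor *:%R *:%R tens
  tens_bilinear.

Definition tens_lift (W : lmodType F) (b : M -> N -> W) (t : tensor) : W :=
  \sum_i \sum_j t i j *: b (r2v (delta_mx 0 i)) (r2v (delta_mx 0 j)).

Fact tens_lift_linear (W : lmodType F) (b : M -> N -> W) : linear (tens_lift b).
Proof.
move=> a t t'; rewrite /tens_lift scaler_sumr -big_split; apply: eq_bigr => i _.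
rewrite scaler_sumr -big_split; apply: eq_bigr => j _ /=.
by rewrite !mxE scalerDl scalerA.
Qed.

HB.instance Definition _ (W : lmodType F) (b : M -> N -> W) :=
  GRing.isLinear.Build F tensor W *:%R (tens_lift b) (tens_lift_linear b).

Lemma tens_liftE (W : lmodType F) (b : M -> N -> W) :
  bilinear_for *:%R *:%R b -> forall m n, tens_lift b (tens m n) = b m n.
Proof.
move=> bP m n; pose B := bilinear_of bP.
have rs (V : vectType F) (v : V) :
    v = \sum_i v2r v 0 i *: r2v (delta_mx 0 i).
  rewrite -[LHS]v2rK [X in r2v X = _](row_sum_delta (v2r v)) linear_sum.
  by apply: eq_bigr => i _; rewrite linearZ.
have -> : b m n = B (\sum_i v2r m 0 i *: r2v (delta_mx 0 i))
  (\sum_i v2r n 0 i *: r2v (delta_mx 0 i)) by rewrite -!rs.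
rewrite linear_sumlz; apply: eq_bigr => i _.
rewrite linear_sumr; apply: eq_bigr => j _.
by rewrite linearZl_LR linearZr scalerA !mxE big_ord1 mxE.
Qed.

Lemma tens_decomp (t : tensor) :
  t = \sum_i \sum_j t i j *: tens (r2v (delta_mx 0 i)) (r2v (delta_mx 0 j)).
Proof.
rewrite {1}[t]matrix_sum_delta; apply: eq_bigr => i _; apply: eq_bigr => j _.
by rewrite /tens !r2vK trmx_delta mul_delta_mx.
Qed.

Lemma tens_ext (W : lmodType F) (f g : {linear tensor -> W}) :
  (forall m n, f (tens m n) = g (tens m n)) -> f =1 g.
Proof.
move=> fg t; rewrite (tens_decomp t) !linear_sum; apply: eq_bigr => i _.
by rewrite !linear_sum; apply: eq_bigr => j _; rewrite !linearZ /= fg.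
Qed.

Lemma tens_mem (W : vectType F) (S : {vspace W}) (f : tensor -> W) :
  linear f -> (forall m n, f (tens m n) \in S) -> forall t, f t \in S.
Proof.
move=> fP fS t; pose f' : {linear tensor -> W} :=
  HB.pack f (GRing.isLinear.Build F tensor W *:%R f fP).
rewrite (tens_decomp t) -[f]/(f' : _ -> _) linear_sum rpred_sum // => i _.
by rewrite linear_sum rpred_sum // => j _; rewrite linearZ rpredZ //; apply: fS.
Qed.

End Tensor.

Local Notation "m ⊗ n" := (tens m n)
  (at level 40, left associativity) : leibniz_scope.

Section TruncatedTensor.
Variables (F : fieldType) (L : leibnizType F) (M N : bimodule L).

Let tlb (x : L) (m : M) (n : N) : tensor M N := (x *> m) ⊗ n + m ⊗ (x *> n).
Let trb (x : L) (m : M) (n : N) : tensor M N := (m <* x) ⊗ n + m ⊗ (n <* x).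

Let tlb_bilinear x : bilinear_for *:%R *:%R (tlb x).
Proof.
split=> [n a m m'|m a n n']; rewrite /tlb.
  by rewrite linearPr !linearPl /= scalerDr addrACA.
by rewrite !linearPr /= scalerDr addrACA.
Qed.

Let trb_bilinear x : bilinear_for *:%R *:%R (trb x).
Proof.
split=> [n a m m'|m a n n']; rewrite /trb.
  by rewrite linearPl !linearPl /= scalerDr addrACA.
by rewrite linearPl !linearPr /= scalerDr addrACA.
Qed.

Fact tensor_lact_bilinear :
  bilinear_for *:%R *:%R (fun (x : L) (t : tensor M N) => tens_lift (tlb x) t).
Proof.
split=> [t a x y|x a t t']; last by rewrite linearP.
rewrite /= /tens_lift scaler_sumr -big_split; apply: eq_bigr => i _.
rewrite scaler_sumr -big_split; apply: eq_bigr => j _ /=.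
rewrite scalerA mulrC -scalerA -scalerDr; congr (_ *: _); rewrite /tlb.
by rewrite !linearPl linearPr /= scalerDr addrACA.
Qed.

Fact tensor_ract_bilinear :
  bilinear_for *:%R *:%R (fun (t : tensor M N) (x : L) => tens_lift (trb x) t).
Proof.
split=> [x a t t'|t a x y]; first by rewrite linearP.
rewrite /= /tens_lift scaler_sumr -big_split; apply: eq_bigr => i _.
rewrite scaler_sumr -big_split; apply: eq_bigr => j _ /=.
rewrite scalerA mulrC -scalerA -scalerDr; congr (_ *: _); rewrite /trb.
by rewrite !linearPr linearPl /= scalerDr addrACA.
Qed.

Definition tensor_lact := bilinear_of tensor_lact_bilinear.
Definition tensor_ract := bilinear_of tensor_ract_bilinear.

Lemma tensor_lactE x m n :
  tensor_lact x (m ⊗ n) = (x *> m) ⊗ n + m ⊗ (x *> n).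
Proof. exact: (tens_liftE (tlb_bilinear x)). Qed.

Lemma tensor_ractE x m n :
  tensor_ract (m ⊗ n) x = (m <* x) ⊗ n + m ⊗ (n <* x).
Proof. exact: (tens_liftE (trb_bilinear x)). Qed.

Definition contains_trunc_gens (T : {vspace tensor M N}) : Prop :=
  forall (x y : L) (m : M) (n : N),
    (x *> m + m <* x) ⊗ (n <* y) + (m <* y) ⊗ (x *> n + n <* x) \in T.

Definition is_truncation (T : {vspace tensor M N}) : Prop :=
  [/\ stable tensor_lact tensor_ract T, contains_trunc_gens T &
    forall S : {vspace tensor M N}, stable tensor_lact tensor_ract S ->
      contains_trunc_gens S -> (T <= S)%VS].

Lemma truncation_exists : exists T, is_truncation T.
Proof.
pose P S := stable tensor_lact tensor_ract S /\ contains_trunc_gens S.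
have exP : exists d, `[< exists2 S, P S & \dim S = d >].
  exists (\dim {:tensor M N}); apply/asboolP; exists fullv => //.
  by split; [apply: stablef | move=> *; rewrite memvf].
case: (ex_minnP exP) => d /asboolP[T [sT gT] dT] minT.
exists T; split=> // S sS gS; apply/capv_idPl/eqP.
rewrite eqEdim capvSl dT minT //; apply/asboolP; exists (T :&: S)%VS => //.
by split; [apply: stableI | move=> *; rewrite memv_cap gT gS].
Qed.

Definition truncation : {vspace tensor M N} := sval (cid truncation_exists).

Lemma truncationP : is_truncation truncation.
Proof. exact: (svalP (cid _)). Qed.

Let sT : stable tensor_lact tensor_ract truncation.
Proof. by case: truncationP. Qed.

Let lin_aux (V : vectType F) (a : F) (p p' q q' : V) :
  a *: p + p' - (a *: q + q') = a *: (p - q) + (p' - q').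
Proof. by rewrite opprD addrACA scalerBr. Qed.

Fact trunc_LLM x y t : tensor_lact (x ** y) t -
  (tensor_lact x (tensor_lact y t) - tensor_lact y (tensor_lact x t))
  \in truncation.
Proof.
move: t; apply: tens_mem => [a u v|m n]; first by rewrite !linearPr !lin_aux.
rewrite !tensor_lactE !linearDr !tensor_lactE !bimodule_LLM linearBl linearBr.
set X := (X in X \in _); suff -> : X = 0 by apply: mem0v.
by rewrite /X; apply/matrixP => i j; rewrite !mxE; ring.
Qed.

Fact trunc_LML x y t : tensor_ract (tensor_lact x t) y -
  (tensor_lact x (tensor_ract t y) - tensor_ract t (x ** y)) \in truncation.
Proof.
move: t; apply: tens_mem => [a u v|m n].
  by rewrite !(linearPr, linearPl) !lin_aux.
rewrite !(tensor_lactE, tensor_ractE) linearDl linearDr.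
rewrite !(tensor_lactE, tensor_ractE) !bimodule_LML linearBl linearBr.
set X := (X in X \in _); suff -> : X = 0 by apply: mem0v.
by rewrite /X; apply/matrixP => i j; rewrite !mxE; ring.
Qed.

Fact trunc_MLL x y t : tensor_ract (tensor_ract t x) y -
  (tensor_ract t (x ** y) - tensor_lact x (tensor_ract t y)) \in truncation.
Proof.
move: t; apply: tens_mem => [a u v|m n].
  by rewrite !(linearPr, linearPl) !lin_aux.
rewrite !(tensor_lactE, tensor_ractE) linearDl linearDr.
rewrite !(tensor_lactE, tensor_ractE) !bimodule_MLL linearBl linearBr.
have [_ gT _] := truncationP; have := gT x y m n.
rewrite linearDl linearDr; set X := (X in X \in _ -> _).
set Y := (Y in _ -> Y \in _); suff -> : Y = X by [].
by rewrite /X /Y; apply/matrixP => i j; rewrite !mxE; ring.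
Qed.

Fact trunc_tensor_law : bimodule_law (quot_lact sT) (quot_ract sT).
Proof.
split=> x y q; have [t ->] := lpi_surj q; rewrite !(quot_lactE, quot_ractE).
- by rewrite -linearB; apply/eq_lpi/trunc_LLM.
- by rewrite -linearB; apply/eq_lpi/trunc_LML.
- by rewrite -linearB; apply/eq_lpi/trunc_MLL.
Qed.

Definition trunc_tensor : bimodule L := Bimodule trunc_tensor_law.

End TruncatedTensor.

(** * The Grothendieck ring *)

Section GrothendieckRing.
Local Open Scope classical_set_scope.
Variables (F : fieldType) (L : leibnizType F).

(* The finite-dimensional irreducible bimodules carried by some F^n: since all
   [vectType]s live one universe above [choiceType], isomorphism classes are
   formed from this small family, which meets each of them
   ([irr_bimodule_exists]). *)
Record irr_bimodule := IrrBimodule {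
  irr_dim : nat;
  irr_lact : {bilinear L -> 'rV[F]_irr_dim -> 'rV[F]_irr_dim};
  irr_ract : {bilinear 'rV[F]_irr_dim -> L -> 'rV[F]_irr_dim};
  irr_law : bimodule_law irr_lact irr_ract;
  irr_irreducible : irreducible (Bimodule irr_law)
}.

Coercion bimodule_of_irr (M : irr_bimodule) : bimodule L :=
  Bimodule (irr_law M).

Lemma irr_bimodule_exists (M : bimodule L) :
  irreducible M -> exists N : irr_bimodule, bimodule_iso M N.
Proof.
move=> [[m m0] Mirr].
pose l (x : L) (v : 'rV[F]_(dim M)) := v2r (x *> r2v v : M).
pose r (v : 'rV[F]_(dim M)) (x : L) := v2r (r2v v <* x : M).
have lP : bilinear_for *:%R *:%R l.
  split=> [v a x y|x a v w]; rewrite /l; first by rewrite linearPl linearP.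
  by rewrite linearP linearPr linearP.
have rP : bilinear_for *:%R *:%R r.
  split=> [x a v w|v a x y]; rewrite /r; last by rewrite linearPr linearP.
  by rewrite linearP linearPl linearP.
have law : bimodule_law (bilinear_of lP) (bilinear_of rP).
  split=> x y v; rewrite /= /l /r !v2rK.
  - by rewrite bimodule_LLM linearB.
  - by rewrite bimodule_LML linearB.
  - by rewrite bimodule_MLL linearB.
have irr : irreducible (Bimodule law).
  split; first by exists (v2r m); rewrite (can2_eq v2rK r2vK) linear0.
  move=> U; pose S := (linfun (v2r : M -> 'rV[F]_(dim M)) @^-1: U)%VS.
  have SE v : (v \in S) = (v2r v \in (U : {vspace _})).
    by rewrite -memv_preim lfunE.
  have sS : stable (lact M) (ract M) S.
    move=> x v; rewrite !SE => vU; have := subbimoduleP x vU.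
    by rewrite /= /l /r !v2rK.
  have [S0|Sf] := Mirr (Subbimodule sS); [left|right]; apply/eqP.
    rewrite -subv0; apply/subvP => v vU; rewrite memv0.
    have /eqP r0 : r2v v == 0 by rewrite -memv0 -(S0 : S = _) SE r2vK.
    by rewrite -[v]r2vK r0 linear0.
  rewrite eqEsubv subvf; apply/subvP => v _.
  by rewrite -[v]r2vK -SE (Sf : S = _) memvf.
exists (IrrBimodule irr), v2r; split=> [|x v|v x] /=.
- exact: (Bijective v2rK r2vK).
- by rewrite /l v2rK.
- by rewrite /r v2rK.
Qed.

HB.instance Definition _ := gen_eqMixin irr_bimodule.
HB.instance Definition _ := gen_choiceMixin irr_bimodule.

Definition irr_iso : rel irr_bimodule := fun M N => `[< bimodule_iso M N >].

Fact irr_iso_refl : reflexive irr_iso.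
Proof. by move=> M; apply/asboolP/bimodule_iso_refl. Qed.

Fact irr_iso_sym : symmetric irr_iso.
Proof.
by move=> M N; apply/asboolP/asboolP; apply: bimodule_iso_sym.
Qed.

Fact irr_iso_trans : transitive irr_iso.
Proof.
move=> N M K /asboolP MN /asboolP NK; apply/asboolP.
exact: bimodule_iso_trans MN NK.
Qed.

Canonical irr_iso_equiv :=
  EquivRel irr_iso irr_iso_refl irr_iso_sym irr_iso_trans.
Canonical irr_iso_encModRel := defaultEncModRel irr_iso.

Definition Irr : Type := {eq_quot irr_iso}.
HB.instance Definition _ := Choice.on Irr.

Definition irr_class (M : irr_bimodule) : Irr := \pi_{eq_quot irr_iso} M.
Definition irr_repr (S : Irr) : irr_bimodule := @repr _ {eq_quot irr_iso} S.

Lemma irr_reprK S : irr_class (irr_repr S) = S.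
Proof. exact: reprK. Qed.

Lemma eq_irr_class M N : irr_class M = irr_class N <-> bimodule_iso M N.
Proof.
rewrite /irr_class; split=> [/eqP|MN]; first by rewrite piE => /asboolP.
by apply/eqP; rewrite piE; apply/asboolP.
Qed.

Definition Gr : Type := {freeg Irr}.
HB.instance Definition _ := GRing.Lmodule.on Gr.

(* The sum has finite support by [comp_mult_finite]. *)
Definition Gr_class (M : bimodule L) : Gr :=
  \sum_(S \in [set: Irr]) << (comp_mult M (irr_repr S))%:Z *g S >>.

Lemma comp_mult_finite (M : bimodule L) :
  finite_set [set S : Irr | comp_mult M (irr_repr S) != 0%N].
Proof.
rewrite /comp_mult; elim: (comp_factors M) => [|K s IHs].
  by apply: (sub_finite_set _ (@finite_set0 Irr)) => S.
pose A := [set S : Irr | bimodule_iso K (irr_repr S)].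
have Afin : finite_set A.
  have [[S0 AS0]|A0] := pselect (exists S, A S); last first.
    by apply: (sub_finite_set _ (@finite_set0 Irr)) => S AS; apply: A0; exists S.
  apply: (sub_finite_set _ (@finite_set1 Irr S0)) => S AS /=.
  rewrite -[LHS]irr_reprK -[RHS]irr_reprK; apply/eq_irr_class.
  exact: bimodule_iso_trans (bimodule_iso_sym AS) AS0.
have ABfin : finite_set (A `|` [set S : Irr |
    count (fun K => `[< bimodule_iso K (irr_repr S) >]) s != 0%N]).
  by rewrite finite_setU.
apply: (sub_finite_set _ ABfin) => S /=.
by case: asboolP => [KS|_] /= h; [left | right].
Qed.

Lemma coeff_Gr_class M S :
  coeff S (Gr_class M) = (comp_mult M (irr_repr S))%:Z.
Proof.
pose D := [set S : Irr | comp_mult M (irr_repr S) != 0%N].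
have Dfin : finite_set D := comp_mult_finite M.
rewrite /Gr_class -(fsbig_widen D) //; last first.
  by move=> T [_ /=] /negP; rewrite negbK => /eqP ->; rewrite freegU0.
rewrite fsbig_finite // raddf_sum /=.
under eq_bigr => T _ do rewrite coeffU.
have [DS|DS] := boolP (S \in fset_set D).
  rewrite (bigD1_seq S) ?fset_uniq //= eqxx mulr1 big1 ?addr0 // => T nTS.
  by rewrite (negPf nTS) mulr0.
rewrite big_seq big1 => [|T TD]; last first.
  by have [TS|_] := eqVneq T S; [rewrite -TS TD in DS | rewrite mulr0].
move: DS; rewrite in_fset_set // notin_setE /D /= => /negP.
by rewrite negbK => /eqP ->.
Qed.

Definition Gr_mul (a b : Gr) : Gr :=
  fglift (fun S : Irr => fglift (fun T : Irr =>
    Gr_class (trunc_tensor (irr_repr S) (irr_repr T))) b) a.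

Let fgliftD (f : Irr -> Gr) (a b : Gr) :
  fglift f (a + b) = fglift f a + fglift f b.
Proof.
have fB := lift_is_additive f; have f0 : fglift f 0 = 0.
  by rewrite -[X in fglift f X](subrr 0) fB subrr.
by rewrite -{1}[b]opprK fB -[X in _ - fglift f X]sub0r fB f0 sub0r opprK.
Qed.

Lemma Gr_mulDl : left_distributive Gr_mul +%R.
Proof. by move=> a b c; apply: fgliftD. Qed.

Lemma Gr_mulDr : right_distributive Gr_mul +%R.
Proof.
move=> a b c; rewrite /Gr_mul -(Freeg_enum a) !fglift_Freeg /prelift -big_split.
by apply: eq_bigr => p _; rewrite fgliftD scalerDr.
Qed.

Lemma Gr_mul_basis (S T : Irr) :
  Gr_mul << S >> << T >> = Gr_class (trunc_tensor (irr_repr S) (irr_repr T)).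
Proof. by rewrite /Gr_mul !liftU !scale1r. Qed.

End GrothendieckRing.

(* Main.v *)
Require Import Defs.
From HB Require Import structures.
From mathcomp Require Import all_boot all_order all_algebra.
From mathcomp Require Import sesquilinear boolp freeg.

(** Irreducible bimodules are symmetric ([m.x = - x.m]) or antisymmetric
    ([m.x = 0]).  Truncation does nothing to the product of two symmetric ones,
    but kills the product of a symmetric and an antisymmetric one on both of
    which L acts non-trivially, since there the generators reduce to
    [(y.m) ⊗ (x.n)].  Let V be an irreducible left module with [L.V <> 0], and
    let M, N, K be the symmetric bimodule on V, the symmetric one on V*, and
    the antisymmetric one on V.  Then [N][K] = 0, whereas the pairing of V with
    V* makes the trivial bimodule a composition factor of [M ⊗ N], so [K]
    occurs in ([M][N])[K].

    Over an arbitrary field, V is found without Ado's theorem: take L/J for a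
    proper left ideal J of least positive codimension.  If L acts on it by
    zero, a coordinate functional on L/J vanishes on all products and defines a
    non-trivial one-dimensional module. *)

Set Implicit Arguments.
Unset Strict Implicit.
Unset Printing Implicit Defensive.

Import Order.TTheory GRing.Theory Num.Theory.
Local Open Scope ring_scope.

Local Notation "x ** y" := (lmul x y) (at level 40, left associativity).
Local Notation "x *> m" := (lact _ x m) (at level 40, left associativity).
Local Notation "m <* x" := (ract _ m x) (at level 40, left associativity).
Local Notation "m ⊗ n" := (tens m n) (at level 40, left associativity).

(** * Irreducible matrix representations: duality and existence *)

Section MatrixRep.
Variables (F : fieldType) (L : leibnizType F).

(* Elements of L act on row vectors by [x . v = v *m A x]. *)
Definition leibniz_rep n (A : L -> 'M[F]_n) : Prop :=
  forall x y, A (x ** y) = A y *m A x - A x *m A y.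

(** Subspaces are encoded as row spaces of square matrices. The case [n = 0] is included, so [0 < n]
    is asked separately. *)
Definition irreducible_rep n (A : L -> 'M[F]_n) : Prop :=
  forall U : 'M[F]_n, (forall x, (U *m A x <= U)%MS) -> U = 0 \/ row_full U.

Lemma leibniz_rep_dual n (A : L -> 'M[F]_n) :
  leibniz_rep A -> leibniz_rep (fun x => - (A x)^T).
Proof.
move=> AP x y; rewrite AP linearB /= !trmx_mul.
by rewrite !mulNmx !mulmxN !opprK opprB.
Qed.

(** The rows of [kermx U^T] form the annihilator of [U], viewed as a space of functionals. The
    annihilator of an invariant subspace is invariant; if it is zero then [U] is everything, and if
    it is everything then [U] is zero. *)
Lemma irreducible_rep_dual n (A : L -> 'M[F]_n) :
  irreducible_rep A -> irreducible_rep (fun x => - (A x)^T).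
Proof.
move=> Airr U sU.
have [x||] := Airr (kermx U^T).
- apply/sub_kermxP; rewrite -mulmxA.
  have /submxP[D UD] := sU x; rewrite mulmxN in UD.
  have -> : A x *m U^T = (U *m (A x)^T)^T by rewrite trmx_mul trmxK.
  rewrite -[U *m (A x)^T]opprK UD linearN /= trmx_mul mulmxN mulmxA mulmx_ker.
  by rewrite mul0mx oppr0.
- move=> /eqP; rewrite kermx_eq0 => Ufree; right.
  by rewrite row_full_unit -unitmx_tr -row_free_unit.
- rewrite row_full_unit => ker_unit; left.
  have := mulmx_ker U^T; move=> /(congr1 (mulmx (invmx (kermx U^T)))).
  by rewrite mulKmx // mulmx0 => /(congr1 trmx); rewrite trmxK trmx0.
Qed.

Lemma irreducible_rep1 (A : L -> 'M[F]_1) : irreducible_rep A.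
Proof.
move=> U _; have [->|U0] := eqVneq U 0; [by left|right].
by rewrite /row_full eqn_leq rank_leq_col lt0n mxrank_eq0.
Qed.

(** A predicate, since [L] may be infinite dimensional. Left multiplication makes L/J a left
    module. *)
Definition left_ideal (J : L -> Prop) : Prop :=
  [/\ J 0, forall a x y, J x -> J y -> J (a *: x + y) &
      forall x y, J y -> J (x ** y)].

Definition spans_mod (J : L -> Prop) k (s : 'I_k -> L) : Prop :=
  forall v, exists c : 'rV[F]_k, J (v - \sum_i c 0 i *: s i).

(** Exchange argument: a relation modulo [J] with non-zero [j]-th coefficient expresses [s j]
    through the other generators. *)
Lemma spans_mod_drop J k (s : 'I_k.+1 -> L) (c : 'rV_k.+1) j :
  left_ideal J -> spans_mod J s -> J (\sum_i c 0 i *: s i) -> c 0 j != 0 ->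
  spans_mod J (fun i => s (fintype.lift j i)).
Proof.
move=> [_ Jlin _] Js Jc cj v; have [d Jd] := Js v.
(* The multiple [d 0 j / c 0 j] of the relation [c] is what cancels [s j] in the expansion [d] of
   [v]. *)
exists (\row_i (d 0 (fintype.lift j i) - d 0 j / c 0 j * c 0 (fintype.lift j i))).
have := Jlin (d 0 j / c 0 j) _ _ Jc Jd; congr (J _).
rewrite addrCA; congr (_ + _); rewrite scaler_sumr.
rewrite (bigD1_ord j) //= [X in _ - X](bigD1_ord j) //= scalerA divfK //.
rewrite opprD addrACA subrr add0r -sumrB -sumrN; apply: eq_bigr => i _.
by rewrite mxE scalerBl opprB scalerA.
Qed.

(* Minimizing k over all proper left ideals at once makes s a basis modulo J
   and, applied to larger J', makes L/J irreducible. *)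
Lemma spans_mod_min :
  (exists x : L, x != 0) -> finite_dimensional (canonical_lie L) ->
  exists (J : L -> Prop) k (s : 'I_k -> L),
  [/\ left_ideal J, exists x, ~ J x, spans_mod J s &
   forall J' (c : 'rV_k), left_ideal J' -> (exists x, ~ J' x) ->
     spans_mod J' s -> J' (\sum_i c 0 i *: s i) -> c = 0].
Proof.
move=> [x0 x0_neq0] [s sP].
pose P k := `[< exists J (s : 'I_k -> L),
  [/\ left_ideal J, exists x, ~ J x & spans_mod J s] >].
have exP : exists k, P k.
  exists (size s); apply/asboolP.
  exists (fun x => x \in leib_kernel (L := L)), (fun i => lrepr s`_i); split.
  - split; first exact: rpred0.
      by move=> a x y xJ yJ; rewrite rpredD // rpredZ.
    exact: leib_kernel_mull.
  (* Leib(L) is proper: its elements annihilate [L] from the left, so if it were all of [L], every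
     square would vanish and Leib(L) = L would be zero. *)
  - apply: contrapT => kerT; case/negP: x0_neq0.
    have {}kerT (x : L) : x \in leib_kernel (L := L).
      by apply: contrapT => xJ; apply: kerT; exists x.
    have /asboolP[t ->] := kerT x0.
    by rewrite big1 // => p _; rewrite leib_kernel_mulr ?kerT // scaler0.
  - move=> v; have [c cP] := sP (lpi _ v).
    exists (\row_i c i); apply/eq_lpi; rewrite [LHS]cP linear_sum.
    by apply: eq_bigr => i _; rewrite linearZ /= lreprK mxE.
case: (ex_minnP exP) => k /asboolP[J [t [JP Jproper Jt]]] kmin.
exists J, k, t; split=> // J' c J'P J'proper J't J'c.
apply/rowP => j; rewrite mxE; apply/eqP/negP => /negP cj.
case: k t Jt kmin c j J't J'c cj => [|k] t Jt kmin c j J't J'c cj.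
  by have := ltn_ord j.
have /kmin : P k.
  apply/asboolP; exists J', (fun i => t (fintype.lift j i)); split=> //.
  exact: spans_mod_drop J'c cj.
by rewrite ltnn.
Qed.

Lemma irreducible_rep_exists :
  (exists x : L, x != 0) -> finite_dimensional (canonical_lie L) ->
  exists n (A : {linear L -> 'M[F]_n}),
    [/\ leibniz_rep A, irreducible_rep A & exists x, A x != 0].
Proof.
move=> L_neq0 L_fin.
have [J [k [s [JP [z0 z0J] Js smin]]]] := spans_mod_min L_neq0 L_fin.
have [J0 Jlin Jmul] := JP.
have JD x y : J x -> J y -> J (x + y).
  by move=> Jx Jy; rewrite -[x]scale1r; apply: Jlin.
have JB x y : J x -> J y -> J (x - y).
  by move=> Jx Jy; rewrite addrC -scaleN1r; apply: Jlin.
have JZ a x : J x -> J (a *: x) by move=> Jx; rewrite -[_ *: _]addr0; apply: Jlin.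
pose lc (c : 'rV_k) : L := \sum_i c 0 i *: s i.
have lcP a c d : lc (a *: c + d) = a *: lc c + lc d.
  rewrite /lc scaler_sumr -big_split; apply: eq_bigr => i _.
  by rewrite !mxE scalerDl scalerA.
have lc_inj c d : J (lc c - lc d) -> c = d.
  move=> Jcd; apply/eqP; rewrite -subr_eq0; apply/eqP/(smin J) => //.
    by exists z0.
  by rewrite -/(lc _) addrC -scaleN1r lcP scaleN1r addrC.
(* Coordinates modulo [J], unique by [lc_inj], that is, by the minimality of [k]. *)
pose psi v : 'rV_k := projT1 (cid (Js v)).
have psiP v : J (v - lc (psi v)) by rewrite /psi; case: cid.
have psi_eq v c : J (v - lc c) -> psi v = c.
  move=> Jv; apply: lc_inj.
  have -> : lc (psi v) - lc c = (v - lc c) - (v - lc (psi v)).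
    by rewrite opprB [RHS]addrC addrA subrK.
  exact: JB.
have psi_lin : linear psi.
  move=> a x y; apply: psi_eq; rewrite lcP opprD addrACA -scalerBr.
  exact: Jlin.
have psiK c : psi (lc c) = c by apply: psi_eq; rewrite subrr.
pose Psi : {linear L -> 'rV[F]_k} :=
  HB.pack psi (GRing.isLinear.Build F L 'rV_k *:%R psi psi_lin).
have psi0 x : J x -> psi x = 0.
  move=> Jx; apply: psi_eq; rewrite /lc big1 ?subr0 // => i _.
  by rewrite mxE scale0r.
(* The matrix of left multiplication by [x] on L/J, in the basis of the classes of the [s i]. *)
pose A (x : L) : 'M[F]_k := \matrix_i psi (x ** s i).
have A_lin : linear A.
  move=> a x y; apply/row_matrixP => i.
  by rewrite linearP /= !rowK linearPl psi_lin.
have AE x y : psi y *m A x = psi (x ** y).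
  have : psi (x ** (y - lc (psi y))) = 0 by apply/psi0/Jmul.
  rewrite linearBr -[psi]/(Psi : _ -> _) linearB => /subr0_eq ->.
  rewrite /lc linear_sumr linear_sum mulmx_sum_row; apply: eq_bigr => i _.
  by rewrite rowK linearZr linearZ.
pose A' : {linear L -> 'M[F]_k} :=
  HB.pack A (GRing.isLinear.Build F L 'M_k *:%R A A_lin).
have AP : leibniz_rep A.
  move=> x y; apply/row_matrixP => i; rewrite !rowE.
  rewrite mulmxBr !mulmxA -[delta_mx 0 i]psiK !AE lmul_leibniz.
  by rewrite -[psi]/(Psi : _ -> _) linearD addrK.
have A_irr : irreducible_rep A.
  move=> U sU; have [->|U0] := eqVneq U 0; [by left|right].
  apply: contrapT => /negP Unfull.
  (* The preimage of a proper invariant [U] is a proper left ideal containing [J]. Each row of [U]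
     is a relation modulo it, hence zero by minimality of [k]. *)
  pose J' x := (psi x <= U)%MS.
  have J'P : left_ideal J'.
    split; rewrite /J'; first by rewrite psi0 ?sub0mx.
      by move=> a x y xU yU; rewrite psi_lin addmx_sub ?scalemx_sub.
    move=> x y yU; rewrite -AE.
    exact: submx_trans (submxMr _ yU) (sU x).
  case/negP: U0; apply/eqP/row_matrixP => i; rewrite row0.
  apply: (smin J') => //.
  - apply: contrapT => J'T; case/negP: Unfull; rewrite -sub1mx.
    apply/row_subP => j; apply: contrapT => jU; apply: J'T.
    by exists (lc (row j 1%:M)); rewrite /J' psiK.
  - move=> v; exists (psi v); rewrite /J' (psi0 _ (psiP v)).
    exact: sub0mx.
  - by rewrite /J' psiK row_sub.
have [[x Ax]|A0] := pselect (exists x, A x != 0).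
  by exists k, A'; split=> //; exists x.
have {}A0 x y : psi (x ** y) = 0.
  rewrite -AE; have [->|Ax] := eqVneq (A x) 0; first by rewrite mulmx0.
  by case: A0; exists x.
have /rV0Pn[j z0j] : psi z0 != 0.
  apply: contra_notN z0J => /eqP z00; have := psiP z0.
  rewrite z00 /lc big1 ?subr0 // => i _.
  by rewrite mxE scale0r.
(* Here [psi] vanishes on all products, so each of its coordinates is a one-dimensional
   representation; the [j]-th one is non-zero at [z0]. *)
pose B (x : L) : 'M[F]_1 := (psi x 0 j)%:M.
have B_lin : linear B.
  by move=> a x y; rewrite /B psi_lin !mxE raddfD /= -scale_scalar_mx.
pose B' : {linear L -> 'M[F]_1} :=
  HB.pack B (GRing.isLinear.Build F L 'M_1 *:%R B B_lin).
exists 1, B'; split=> /=.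
- move=> x y; rewrite /B A0 mxE raddf0 -!scalar_mxM mulrC.
  by rewrite subrr.
- exact: irreducible_rep1.
- exists z0; rewrite /B; apply: contra z0j => /eqP /matrixP /(_ 0 0).
  by rewrite !mxE => /eqP.
Qed.

End MatrixRep.

(** * Bimodules built from a representation *)

Section RepBimodule.
Variables (F : fieldType) (L : leibnizType F) (n : nat).
Variables (A : {linear L -> 'M[F]_n}) (c : F).
Hypotheses (AP : leibniz_rep A) (cP : c * c = - c).

Let rep_lact_fun (x : L) (v : 'rV[F]_n) : 'rV[F]_n := v *m A x.
Let rep_ract_fun (v : 'rV[F]_n) (x : L) : 'rV[F]_n := c *: (v *m A x).

Fact rep_lact_bilinear : bilinear_for *:%R *:%R rep_lact_fun.
Proof.
split=> [v a x y|x a v w]; rewrite /rep_lact_fun.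
  by rewrite linearP /= mulmxDr -scalemxAr.
by rewrite mulmxDl -scalemxAl.
Qed.

Fact rep_ract_bilinear : bilinear_for *:%R *:%R rep_ract_fun.
Proof.
split=> [x a v w|v a x y]; rewrite /rep_ract_fun.
  by rewrite mulmxDl -scalemxAl scalerDr scalerA mulrC -scalerA.
by rewrite linearP /= mulmxDr -scalemxAr scalerDr scalerA mulrC -scalerA.
Qed.

(* The relation [c * c = - c] means [c = -1] (symmetric bimodule) or [c = 0]
   (antisymmetric bimodule). *)
Fact rep_bimodule_law : bimodule_law (bilinear_of rep_lact_bilinear)
  (bilinear_of rep_ract_bilinear).
Proof.
split=> x y v; rewrite /= /rep_lact_fun /rep_ract_fun AP mulmxBr !mulmxA //.
  by rewrite -!scalemxAl -scalerBr subKr.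
rewrite -!scalemxAl scalerA cP scaleNr -scalerBr.
by rewrite addrAC subrr sub0r scalerN.
Qed.

Definition rep_bimodule : bimodule L := Bimodule rep_bimodule_law.

Lemma rep_bimodule_irreducible :
  (0 < n)%N -> irreducible_rep A -> irreducible rep_bimodule.
Proof.
move=> n_gt0 Airr; split.
  exists (const_mx 1 : 'rV[F]_n); apply/eqP => /rowP/(_ (Ordinal n_gt0)).
  by rewrite !mxE => /eqP; rewrite oner_eq0.
(* The matrix of a projection onto [U] has [U] as its row space, which brings the question back to
   [irreducible_rep]. *)
move=> U; pose B := lin1_mx (projv (U : {vspace 'rV[F]_n})).
have BE (v : 'rV[F]_n) : (v <= B)%MS = (v \in (U : {vspace 'rV[F]_n})).
  apply/submxP/idP => [[D ->]|vU]; first by rewrite mul_rV_lin1 memv_proj.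
  by exists v; rewrite mul_rV_lin1 /= projv_id.
have [x||Bfull] := Airr B.
- apply/row_subP => i; rewrite row_mul BE.
  have rU : row i B \in (U : {vspace 'rV[F]_n}) by rewrite -BE row_sub.
  by have [] := @subbimoduleP F L rep_bimodule U x _ rU.
- move=> B0; left; apply/eqP; rewrite -subv0; apply/subvP => v.
  by rewrite -[v \in _]BE B0 submx0 memv0.
- right; apply/eqP; rewrite eqEsubv subvf; apply/subvP => v _.
  by rewrite -[v \in _]BE submx_full.
Qed.

End RepBimodule.

(** * Homomorphisms and composition multiplicities *)

Section Homomorphisms.
Variables (F : fieldType) (L : leibnizType F).
Implicit Types M N K : bimodule L.

Definition bimodule_hom M N (f : M -> N) : Prop :=
  (forall x m, f (x *> m) = x *> f m) /\ (forall x m, f (m <* x) = f m <* x).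

Lemma schur M N (f : {linear M -> N}) :
  irreducible M -> irreducible N -> bimodule_hom f -> (exists m, f m != 0) ->
  bimodule_iso M N.
Proof.
move=> [_ Mirr] [_ Nirr] [fl fr] [m fm].
have skf : stable (lact M) (ract M) (lker (linfun f)).
  move=> x v; rewrite !memv_ker !lfunE /= => /eqP fv.
  by rewrite fl fr fv linear0r linear0l eqxx.
have sif : stable (lact N) (ract N) (limg (linfun f)).
  move=> x _ /memv_imgP[v _ ->]; rewrite lfunE /= -fl -fr.
  by split; rewrite -[f _]lfunE memv_img ?memvf.
have inj_f : injective f.
  have [/= k0|kf] := Mirr (Subbimodule skf).
    have /lker0P kP : lker (linfun f) == 0%VS by rewrite k0.
    by move=> u v fuv; apply: kP; rewrite !lfunE.
  have : m \in lker (linfun f) by rewrite [lker _]kf memvf.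
  by rewrite memv_ker lfunE (negPf fm).
have surj_f n : exists m, f m = n.
  have [/= i0|iF] := Nirr (Subbimodule sif).
    have : f m \in limg (linfun f) by rewrite -[f m]lfunE memv_img ?memvf.
    by rewrite i0 memv0 (negPf fm).
  have /memv_imgP[v _ ->] : n \in limg (linfun f) by rewrite [limg _]iF memvf.
  by exists v; rewrite lfunE.
exists f; split=> //.
pose g n := projT1 (cid (surj_f n)).
have gK : cancel g f by move=> n; rewrite /g; case: cid.
by exists g => // v; apply: inj_f; rewrite gK.
Qed.

(** Induction along the chain while [f] vanishes on [U]. At the first [W] on which [f] is non-zero,
    it induces a non-zero map from W/U to [N], an isomorphism by [schur]. Such a [W] occurs because
    the chain ends at [M]. *)
Lemma comp_chain_mult_gt0 M N (f : {linear M -> N}) (U : subbimodule M)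
    (s : seq (subbimodule M)) :
  irreducible N -> bimodule_hom f -> (exists m, f m != 0) -> comp_chain U s ->
  (forall u, u \in (U : {vspace M}) -> f u = 0) ->
  (0 < count (fun K => `[< bimodule_iso K N >]) (pairmap (@factor F L M) U s))%N.
Proof.
move=> Nirr [fl fr] [m fm]; elim: s U => [|W s IHs] U /=.
  by move=> Uf fU; case/eqP: fm; apply: fU; rewrite Uf memvf.
move=> [UW Firr sP] fU.
have [fW|] := pselect (forall w, w \in (W : {vspace M}) -> f w = 0).
  by rewrite addn_gt0 IHs ?orbT.
move=> /existsNP[w /not_implyP[wW /eqP fw]].
rewrite addn_gt0 lt0b; apply/orP; left; apply/asboolP.
set R := (linfun (vsval : subvs_of W -> M) @^-1: U)%VS.
have fR (v : subvs_of W) : v \in R -> f (vsval v) = 0.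
  by rewrite -memv_preim lfunE; apply: fU.
pose g (q : factor U W) : N := f (vsval (lrepr q)).
have gE (v : subvs_of W) : g (lpi (pred_of_vspace R) v) = f (vsval v).
  apply/eqP; rewrite -subr_eq0 -linearB -linearB; apply/eqP/fR.
  exact: lrepr_lpi.
have g_lin : linear g.
  move=> a p q; have [u ->] := lpi_surj p; have [v ->] := lpi_surj q.
  by rewrite -linearP !gE !linearP.
pose G : {linear factor U W -> N} :=
  HB.pack g (GRing.isLinear.Build F (factor U W) N *:%R g g_lin).
apply: (@schur _ _ G) => //; last first.
  by exists (lpi (pred_of_vspace R) (Subvs wW)); rewrite [G _]gE.
split=> x q; have [v ->] := lpi_surj q; rewrite [G (lpi _ v)]gE.
  by rewrite [_ *> _]quot_lactE [LHS]gE fl.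
by rewrite [_ <* _]quot_ractE [LHS]gE fr.
Qed.

Lemma comp_mult_gt0 M N (f : {linear M -> N}) :
  irreducible N -> bimodule_hom f -> (exists m, f m != 0) ->
  (0 < comp_mult M N)%N.
Proof.
move=> Nirr fP fm; apply: (comp_chain_mult_gt0 Nirr fP fm).
  exact: comp_seriesP.
by move=> u; rewrite memv0 => /eqP ->; rewrite linear0.
Qed.

(** [Gr_mul] works with chosen representatives; this isomorphism transports properties of explicit
    bimodules to them. *)
Lemma irr_repr_iso (N : irr_bimodule L) :
  bimodule_iso N (irr_repr (irr_class N)).
Proof. by apply/eq_irr_class; rewrite irr_reprK. Qed.

Lemma Gr_class_gt0 M (N : irr_bimodule L) (f : {linear M -> N}) :
  bimodule_hom f -> (exists m, f m != 0) ->
  0 < coeff (irr_class N) (Gr_class M).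
Proof.
move=> [fl fr] [m fm]; rewrite coeff_Gr_class.
have [g [gb gl gr]] := irr_repr_iso N.
rewrite ltz_nat; apply: (@comp_mult_gt0 _ _ (g \o f)).
- exact: irr_irreducible.
- by split=> x v /=; rewrite ?fl ?fr.
- exists m => /=; rewrite -(linear0 g); apply: contra fm => /eqP/(bij_inj gb) ->.
  by rewrite eqxx.
Qed.

(** The composition series is empty, since a factor would be irreducible and so contain a non-zero
    vector. *)
Lemma Gr_class_eq0 M : (forall m : M, m = 0) -> Gr_class M = 0.
Proof.
move=> M0; apply/eqP/freeg_eqP => S; rewrite coeff_Gr_class coeff0.
rewrite /comp_mult /comp_factors; have := @comp_seriesP F L M.
case: (comp_series M) => [|W s] //= [_ [[q q0] _] _].
case/eqP: q0; have [v ->] := lpi_surj q.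
by rewrite (_ : v = 0) ?linear0 //; apply: val_inj; rewrite /= [LHS]M0.
Qed.

End Homomorphisms.

(** Among the subspaces contained in [P], take one of maximal dimension: adding the line of a vector
    satisfying [P] cannot enlarge it. *)
Lemma pred_vspace (F : fieldType) (V : vectType F) (P : V -> Prop) :
  P 0 -> (forall a u v, P u -> P v -> P (a *: u + v)) ->
  exists U : {vspace V}, forall v, v \in U <-> P v.
Proof.
move=> P0 Plin.
pose Q d := `[< exists2 U : {vspace V}, (forall v, v \in U -> P v) & \dim U = d >].
have exQ : exists d, Q d.
  exists 0%N; apply/asboolP; exists 0%VS; last exact: dimv0.
  by move=> v; rewrite memv0 => /eqP ->.
have Qmax d : Q d -> (d <= \dim {:V})%N.
  by move=> /asboolP[U _ <-]; rewrite dimvS ?subvf.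
case: (ex_maxnP exQ Qmax) => d /asboolP[U UP dU] dmax.
exists U => v; split=> [|Pv]; first exact: UP.
have /dmax : Q (\dim (<[v]> + U)%VS).
  apply/asboolP; exists (<[v]> + U)%VS => // _ /memv_addP[_ /vlineP[a ->]] [u uU ->].
  by apply: Plin => //; apply: UP.
rewrite -dU => le_dim; have /eqP -> : U == (<[v]> + U)%VS.
  by rewrite eqEdim addvSr.
by apply: (subvP (addvSl _ _)); apply: memv_line.
Qed.

(** * Vanishing of truncated tensor products, and maps out of them *)

Section TruncatedTensors.
Variables (F : fieldType) (L : leibnizType F).
Implicit Types M N K : bimodule L.

(** The value [c = -1] gives symmetric bimodules and [c = 0] antisymmetric ones. *)
Definition proportional_acts (c : F) M : Prop :=
  forall (x : L) (m : M), m <* x = c *: (x *> m).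

Definition nontrivial M : Prop := exists (x : L) (m : M), x *> m != 0.

Lemma proportional_acts_iso c M N :
  bimodule_iso M N -> proportional_acts c M -> proportional_acts c N.
Proof.
move=> /bimodule_iso_sym[f [fb fl fr]] cM x n; apply: (bij_inj fb).
by rewrite fr cM linearZ /= fl.
Qed.

Lemma nontrivial_iso M N : bimodule_iso M N -> nontrivial M -> nontrivial N.
Proof.
move=> [f [fb fl fr]] [x [m xm]]; exists x, (f m).
rewrite -fl -(linear0 f); apply: contra xm => /eqP/(bij_inj fb) ->.
by rewrite eqxx.
Qed.

(* In other words, M is spanned by L.M. *)
Lemma nontrivial_ind c M (P : M -> Prop) :
  irreducible M -> proportional_acts c M -> nontrivial M ->
  P 0 -> (forall a u v, P u -> P v -> P (a *: u + v)) ->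
  (forall x m, P (x *> m)) -> forall m, P m.
Proof.
move=> [_ Mirr] cM [x0 [m0 xm0]] P0 Plin Pact m.
have [U UP] := pred_vspace P0 Plin.
have sU : stable (lact M) (ract M) U.
  move=> x v _; rewrite cM -[_ *: _]addr0; split; first exact/UP.
  by apply/UP/Plin.
have [/= U0|Uf] := Mirr (Subbimodule sU).
  by have /UP := Pact x0 m0; rewrite U0 memv0 (negPf xm0).
by apply/UP; rewrite [U]Uf memvf.
Qed.

(** The generators become the tensors -(y.m) ⊗ (x.n). By [nontrivial_ind], L.M spans [M] and L.N
    spans [N], so the truncation is the whole tensor product. *)
Lemma trunc_tensor_eq0 M N :
  irreducible M -> irreducible N -> nontrivial M -> nontrivial N ->
  proportional_acts (-1) M -> proportional_acts 0 N ->
  forall t : trunc_tensor M N, t = 0.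
Proof.
move=> Mirr Nirr Mnt Nnt cM cN q; have [t ->] := lpi_surj q.
rewrite -(linear0 (@lpi F _ (pred_of_vspace (truncation M N)))).
apply/eq_lpi; rewrite subr0; move: t; apply: (tens_mem (f := id)) => // m n.
have [_ gT _] := truncationP M N.
move: m; apply: (nontrivial_ind Mirr cM Mnt) => [|a u v uT vT|y m].
- by rewrite linear0l mem0v.
- by rewrite linearPl rpredD // rpredZ.
move: n; apply: (nontrivial_ind Nirr cN Nnt) => [|a u v uT vT|x n].
- by rewrite linear0r mem0v.
- by rewrite linearPr rpredD // rpredZ.
have := gT x y m n; rewrite !cM !cN !scaleN1r !scale0r addr0 subrr.
by rewrite linear0l add0r linearNl rpredN.
Qed.

(** Universal property: the kernel of the map induced on [tensor M N] is stable and contains the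
    generators, so it contains the truncation by minimality. *)
Lemma trunc_lift M N K (b : M -> N -> K) :
  bilinear_for *:%R *:%R b ->
  (forall x m n, x *> b m n = b (x *> m) n + b m (x *> n)) ->
  (forall x m n, b m n <* x = b (m <* x) n + b m (n <* x)) ->
  (forall x y m n,
     b (x *> m + m <* x) (n <* y) + b (m <* y) (x *> n + n <* x) = 0) ->
  (exists m n, b m n != 0) ->
  exists f : {linear trunc_tensor M N -> K},
    bimodule_hom f /\ exists t, f t != 0.
Proof.
move=> bP bl br bT [m0 [n0 bmn]].
pose g : {linear tensor M N -> K} := tens_lift b.
have gE m n : g (m ⊗ n) = b m n by apply: tens_liftE.
have gl x t : g (tensor_lact M N x t) = x *> g t.
  apply: (@tens_ext _ _ _ _ (g \o tensor_lact M N x) (lact K x \o g)) => m n.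
  by rewrite -[LHS]/(g (tensor_lact M N x (m ⊗ n))) tensor_lactE linearD /= !gE bl.
have gr x t : g (tensor_ract M N t x) = g t <* x.
  apply: (@tens_ext _ _ _ _ (g \o applyr (tensor_ract M N) x)
    (applyr (ract K) x \o g)) => m n.
  by rewrite -[LHS]/(g (tensor_ract M N (m ⊗ n) x)) tensor_ractE linearD /= !gE br.
have gT t : t \in truncation M N -> g t = 0.
  have [_ _ Tmin] := truncationP M N.
  have kE u : (u \in lker (linfun g)) = (g u == 0) by rewrite memv_ker lfunE.
  have TS : (truncation M N <= lker (linfun g))%VS.
    apply: Tmin => [x v|x y m n]; rewrite !kE.
      by move=> /eqP gv; rewrite gl gr gv linear0r linear0l eqxx.
    by rewrite linearD !gE bT.
  by move=> /(subvP TS); rewrite kE => /eqP.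
pose f (q : trunc_tensor M N) : K := g (lrepr q).
have fE t : f (lpi (pred_of_vspace (truncation M N)) t) = g t.
  apply/eqP; rewrite -subr_eq0 -linearB; apply/eqP/gT.
  exact: lrepr_lpi.
have f_lin : linear f.
  move=> a p q; have [u ->] := lpi_surj p; have [v ->] := lpi_surj q.
  by rewrite -linearP !fE linearP.
pose f' : {linear trunc_tensor M N -> K} :=
  HB.pack f (GRing.isLinear.Build F (trunc_tensor M N) K *:%R f f_lin).
exists f'; split; last by exists (lpi _ (m0 ⊗ n0)); rewrite [f' _]fE gE.
split=> x q; have [v ->] := lpi_surj q; rewrite [f' (lpi _ v)]fE.
  by rewrite [_ *> _]quot_lactE [LHS]fE gl.
by rewrite [_ <* _]quot_ractE [LHS]fE gr.
Qed.

End TruncatedTensors.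

(** * Positivity of coefficients in the Grothendieck ring *)

Section GrProducts.
Variables (F : fieldType) (L : leibnizType F).
Implicit Types (a : Gr L) (S T U : Irr L) (M N : irr_bimodule L).

Lemma Gr_mulr0 a : Gr_mul a 0 = 0.
Proof. by apply: (addrI (Gr_mul a 0)); rewrite -Gr_mulDr !addr0. Qed.

Lemma Gr_mul0r a : Gr_mul 0 a = 0.
Proof. by apply: (addrI (Gr_mul 0 a)); rewrite -Gr_mulDl !addr0. Qed.

Lemma Gr_mulE a U :
  Gr_mul a << U >> = \sum_(S <- dom a) coeff S a *: Gr_mul << S >> << U >>.
Proof.
have {1}-> : a = \sum_(S <- dom a) (<< coeff S a *g S >> : Gr L).
  exact/esym/freeg_sumE.
rewrite (big_morph (fun b => Gr_mul b << U >>) (fun b c => Gr_mulDl b c << U >>) (Gr_mul0r _)).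
by apply: eq_bigr => S _; rewrite /Gr_mul !liftU !scale1r.
Qed.

(** Nothing cancels: the coefficients of products of basis classes are multiplicities, hence
    non-negative, so the contribution of [S] survives. *)
Lemma coeff_Gr_mul_gt0 a S U :
  (forall T, 0 <= coeff T a) -> 0 < coeff S a ->
  0 < coeff U (Gr_mul << S >> << U >>) -> 0 < coeff U (Gr_mul a << U >>).
Proof.
move=> a_ge0 aS SU; rewrite Gr_mulE raddf_sum (bigD1_seq S) ?uniq_dom //=; last first.
  by rewrite mem_dom gt_eqF.
rewrite coeffZ ltr_wpDr ?mulr_gt0 // sumr_ge0 // => T _.
by rewrite coeffZ mulr_ge0 // Gr_mul_basis coeff_Gr_class.
Qed.

End GrProducts.

(** This and [sqr_zero] supply the condition on [c] in [rep_bimodule], for the symmetric and the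
    antisymmetric case. *)
Lemma sqr_opp1 (F : fieldType) : (-1) * (-1) = - (-1) :> F.
Proof. by rewrite mulrNN mulr1 opprK. Qed.

Lemma sqr_zero (F : fieldType) : 0 * 0 = - 0 :> F.
Proof. by rewrite mulr0 oppr0. Qed.

(** * The trivial bimodule, the dual pairing, and their products *)

Section RepProducts.
Variables (F : fieldType) (L : leibnizType F).

Lemma rep_bimodule_proportional n (A : {linear L -> 'M[F]_n}) c
    (AP : leibniz_rep A) (cP : c * c = - c) :
  proportional_acts c (rep_bimodule AP cP).
Proof. by []. Qed.

Lemma rep_bimodule_nontrivial n (A : {linear L -> 'M[F]_n}) c
    (AP : leibniz_rep A) (cP : c * c = - c) x :
  A x != 0 -> nontrivial (rep_bimodule AP cP).
Proof.
move=> Ax; apply: contrapT => Atriv; case/eqP: Ax.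
apply/row_matrixP => i; rewrite row0 rowE; apply: contrapT => /eqP Axi.
by apply: Atriv; exists x, (delta_mx 0 i : 'rV_n).
Qed.

Definition rep_irr n (A : {linear L -> 'M[F]_n}) c (AP : leibniz_rep A)
    (cP : c * c = - c) (n_gt0 : (0 < n)%N) (Airr : irreducible_rep A) :
    irr_bimodule L :=
  IrrBimodule (rep_bimodule_irreducible AP cP n_gt0 Airr).

Definition trivial_rep : {linear L -> 'M[F]_1} := \0.

Lemma trivial_repP : leibniz_rep trivial_rep.
Proof. by move=> x y; rewrite mul0mx subrr. Qed.

(** For the zero representation the symmetric and antisymmetric bimodules coincide; the choice
    [c = 0] is a convention. *)
Definition trivial_irr : irr_bimodule L :=
  rep_irr trivial_repP (sqr_zero F) (ltn0Sn 0) (@irreducible_rep1 F L trivial_rep).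

Lemma trivial_lact x (e : trivial_irr) : x *> e = 0.
Proof. exact: mulmx0. Qed.

Lemma trivial_ract x (e : trivial_irr) : e <* x = 0.
Proof. exact: scale0r. Qed.

(** Scaling [u] by the coordinate of [e] is a non-zero homomorphism to [U]. It kills the generators,
    because each summand has an action on [E] in its first factor. *)
Lemma coeff_trunc_trivial (E : bimodule L) (U : irr_bimodule L) :
  bimodule_iso E trivial_irr ->
  0 < coeff (irr_class U) (Gr_class (trunc_tensor E U)).
Proof.
move=> [chi [[chi' _ chi'K] chil chir]].
pose b (e : E) (u : U) : U := (chi e : 'rV[F]_1) 0 0 *: u.
have b0 e u : chi e = 0 -> b e u = 0.
  by move=> e0; rewrite /b e0 mxE scale0r.
have chi_l x e : chi (x *> e) = 0 by rewrite chil trivial_lact.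
have chi_r x e : chi (e <* x) = 0 by rewrite chir trivial_ract.
have bP : bilinear_for *:%R *:%R b.
  split=> [u a e e'|e a u u']; rewrite /b.
    by rewrite linearP /= !mxE scalerDl -scalerA.
  by rewrite scalerDr scalerA mulrC -scalerA.
have [||||f [fP fm]] := trunc_lift bP.
- by move=> x e u; rewrite (b0 _ _ (chi_l x e)) add0r /b linearZr.
- by move=> x e u; rewrite (b0 _ _ (chi_r x e)) add0r /b linearZl_LR.
- by move=> x y e u; rewrite (b0 _ _ (chi_r y e)) addr0 b0 // linearD chi_l chi_r addr0.
- have [[u u0] _] := irr_irreducible U.
  exists (chi' (const_mx 1 : 'rV[F]_1)), u.
  by rewrite /b chi'K mxE scale1r.
exact: Gr_class_gt0 fP fm.
Qed.

(** The contragredient representation, named so that it can carry a linear structure. *)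
Definition dual_rep n (A : L -> 'M[F]_n) (x : L) : 'M[F]_n := - (A x)^T.

Lemma dual_rep_is_linear n (A : {linear L -> 'M[F]_n}) : linear (dual_rep A).
Proof. by move=> a x y; rewrite /dual_rep !linearP. Qed.

HB.instance Definition _ n (A : {linear L -> 'M[F]_n}) :=
  GRing.isLinear.Build F L 'M[F]_n *:%R (dual_rep A) (dual_rep_is_linear A).

(** The pairing of V with its dual is invariant, with values in the 1 by 1 matrices that carry
    [trivial_irr]. It kills the generators because both factors are symmetric. *)
Lemma coeff_trunc_dual n (A : {linear L -> 'M[F]_n}) (AP : leibniz_rep A)
    (AdP : leibniz_rep (dual_rep A)) (M N : bimodule L) : (0 < n)%N ->
  bimodule_iso M (rep_bimodule AP (sqr_opp1 F)) ->
  bimodule_iso N (rep_bimodule AdP (sqr_opp1 F)) ->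
  0 < coeff (irr_class trivial_irr) (Gr_class (trunc_tensor M N)).
Proof.
move=> n_gt0 isoM isoN.
have symM x (m : M) : x *> m + m <* x = 0.
  have -> := proportional_acts_iso (bimodule_iso_sym isoM)
    (@rep_bimodule_proportional _ _ _ AP (sqr_opp1 F)) x m.
  by rewrite scaleN1r subrr.
have symN x (m : N) : x *> m + m <* x = 0.
  have -> := proportional_acts_iso (bimodule_iso_sym isoN)
    (@rep_bimodule_proportional _ _ _ AdP (sqr_opp1 F)) x m.
  by rewrite scaleN1r subrr.
have [phi [[phi' _ phi'K] phil phir]] := isoM.
have [psi [[psi' _ psi'K] psil psir]] := isoN.
pose b (m : M) (k : N) : trivial_irr :=
  (phi m : 'rV[F]_n) *m (psi k : 'rV[F]_n)^T.
have bP : bilinear_for *:%R *:%R b.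
  split=> [k a m m'|m a k k']; rewrite /b.
    by rewrite linearP mulmxDl -scalemxAl.
  by rewrite !linearP.
have b_inv x m k : b (x *> m) k + b m (x *> k) = 0.
  rewrite /b phil psil /= /dual_rep mulmxN linearN /= mulmxN.
  by rewrite trmx_mul trmxK mulmxA subrr.
have [||||f [fP fm]] := trunc_lift bP.
- by move=> x m k; rewrite trivial_lact b_inv.
- move=> x m k; rewrite trivial_ract.
  have -> : m <* x = - (x *> m) by apply/eqP; rewrite -addr_eq0 addrC symM.
  have -> : k <* x = - (x *> k) by apply/eqP; rewrite -addr_eq0 addrC symN.
  rewrite [b (- _) _](linearNl (bilinear_of bP)).
  by rewrite [b _ (- _)](linearNr (bilinear_of bP)) -opprD b_inv oppr0.
- move=> x y m k; rewrite symM symN.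
  rewrite [b 0 _](linear0l (bilinear_of bP)).
  by rewrite [b _ 0](linear0r (bilinear_of bP)) addr0.
(* A basis vector pairs to 1 with the dual basis vector of the same index. *)
- pose e : 'rV[F]_n := delta_mx 0 (Ordinal n_gt0).
  exists (phi' e), (psi' e); rewrite /b phi'K psi'K trmx_delta mul_delta_mx.
  apply/eqP => /matrixP/(_ 0 0); rewrite !mxE !eqxx => /eqP.
  by rewrite oner_eq0.
exact: Gr_class_gt0 fP fm.
Qed.

End RepProducts.

(** * The two bracketings of [M][N][K] *)

Theorem proposition5p10 (F : fieldType) (L : leibnizType F)
    (L_neq0 : exists x : L, x != 0)
    (L_Lie_fin : finite_dimensional (canonical_lie L)) :
  ~ associative (@Gr_mul F L).
Proof.
move=> mulA.
have [n [A [AP Airr [x Ax]]]] := irreducible_rep_exists L_neq0 L_Lie_fin.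
have n_gt0 : (0 < n)%N.
  by rewrite -mxrank_eq0 -lt0n in Ax; apply: leq_trans Ax (rank_leq_row _).
have AdP : leibniz_rep (dual_rep A) by apply: leibniz_rep_dual.
have Adirr : irreducible_rep (dual_rep A) by apply: irreducible_rep_dual.
have Adx : dual_rep A x != 0 by rewrite oppr_eq0 trmx_eq0.
pose M := rep_irr AP (sqr_opp1 F) n_gt0 Airr.
pose N := rep_irr AdP (sqr_opp1 F) n_gt0 Adirr.
pose K := rep_irr AP (sqr_zero F) n_gt0 Airr.
have NK0 : Gr_mul << irr_class N >> << irr_class K >> = 0.
  rewrite Gr_mul_basis; apply: Gr_class_eq0.
  apply: trunc_tensor_eq0; try exact: irr_irreducible.
  - exact: nontrivial_iso (irr_repr_iso N) (rep_bimodule_nontrivial _ _ Adx).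
  - exact: nontrivial_iso (irr_repr_iso K) (rep_bimodule_nontrivial _ _ Ax).
  - exact: proportional_acts_iso (irr_repr_iso N) _.
  - exact: proportional_acts_iso (irr_repr_iso K) _.
have : 0 < coeff (irr_class K)
    (Gr_mul (Gr_mul << irr_class M >> << irr_class N >>) << irr_class K >>).
  apply: (@coeff_Gr_mul_gt0 _ _ _ (irr_class (trivial_irr L))).
  - by move=> T; rewrite Gr_mul_basis coeff_Gr_class.
  - rewrite Gr_mul_basis; apply: (@coeff_trunc_dual _ _ _ _ AP AdP) => //.
      exact: bimodule_iso_sym (irr_repr_iso M).
    exact: bimodule_iso_sym (irr_repr_iso N).
  (* The class of [K] is rewritten as that of its representative, the actual second factor of the
     product. *)
  - rewrite Gr_mul_basis -[X in coeff X _]irr_reprK.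
    exact/coeff_trunc_trivial/bimodule_iso_sym/irr_repr_iso.
by rewrite -mulA NK0 Gr_mulr0 coeff0 ltxx.
Qed.
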